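(* Let $G$ be a finite group and $p$ a prime number. In any of the following cases, if the finite space $\mathcal{S}_p(G)$ is contractible then the finite space $\mathcal{A}_p(G)$ is contractible: (1) all maximal $p$-tori of $G$ (i.e. maximal elements of $\mathcal{A}_p(G)$) are conjugate in $G$; (2) $h(\mathcal{A}_p(G))\leq 1$; (3) $|G|_p\leq p^3$.
   Context: All groups and posets are finite. $\mathcal{S}_p(G)$ is the poset of non-trivial $p$-subgroups of $G$ ordered by inclusion, and $\mathcal{A}_p(G)$ is its subposet of non-trivial elementary abelian $p$-subgroups (called $p$-tori). $|G|_p$ is the greatest power of $p$ dividing $|G|$. The height $h(X)$ of a poset $X$ is one less than the maximum number of elements in a chain of $X$. A finite poset $X$ is regarded as a finite topological space whose open sets are its down-sets (subsets $U$ such that $x\in U$, $y\le x$ imply $y\in U$). With this topology, continuous maps are exactly order-preserving maps, and two continuous maps $f,g:X\to Y$ are homotopic if and only if there are order-preserving maps $f=f_0,f_1,\ldots,f_m=g:X\to Y$ such that $f_i$ and $f_{i+1}$ are comparable (pointwise) for each $i$. Contractibility means contractibility of this finite topological space (homotopy equivalence with a point), which is strictly stronger in general than contractibility of the order complex. *)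

(* Defs.v *)
From HB Require Import structures.
From mathcomp Require Import all_boot all_order all_algebra.
From mathcomp Require Import all_fingroup all_solvable.
From mathcomp Require Import classical_sets reals topology normedtype.

Set Implicit Arguments.
Unset Strict Implicit.
Unset Printing Implicit Defensive.

Import Order.TTheory GRing.Theory Num.Theory.
Import numFieldNormedType.Exports.

Local Open Scope classical_set_scope.
Local Open Scope ring_scope.

(* [f] and [g] are continuous because [H] is; the values of [H] outside
   [X * `[0, 1]] are irrelevant. *)
Definition homotopic (R : realType) (X Y : topologicalType) (f g : X -> Y) :=
  exists H : X * R -> Y,
    [/\ {within setT `*` `[0, 1], continuous H},
        forall x, H (x, 0) = f x
      & forall x, H (x, 1) = g x].

Definition homotopy_equivalent (R : realType) (X Y : topologicalType) :=
  exists (f : X -> Y) (g : Y -> X),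
    [/\ continuous f, continuous g,
        homotopic R (g \o f) idfun & homotopic R (f \o g) idfun].

Definition contractible (R : realType) (X : topologicalType) :=
  homotopy_equivalent R X (discrete_topology unit).

Section FiniteSpace.
Local Open Scope order_scope.

(* The alias keeps the down-set topology from being attached to every finite
   poset: some of them already carry another one. *)
Definition finspace (d : Order.disp_t) (X : finPOrderType d) : Type := X.

Definition down_set (d : Order.disp_t) (X : porderType d) (U : set X) :=
  forall x y : X, U x -> y <= x -> U y.

Section Topology.
Context (d : Order.disp_t) (X : finPOrderType d).

HB.instance Definition _ := Order.FinPOrder.on (finspace X).

Let opT : down_set (setT : set (finspace X)).
Proof. by []. Qed.

Let opI : setI_closed (@down_set d (finspace X)).
Proof.
by move=> A B dA dB x y [Ax Bx] yx; split; [apply: dA yx | apply: dB yx].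
Qed.

Let op_bigU (I : Type) (F : I -> set (finspace X)) :
  (forall i, down_set (F i)) -> down_set (\bigcup_i F i).
Proof. by move=> dF x y [i _ Fix] yx; exists i => //; apply: dF yx. Qed.

HB.instance Definition _ :=
  isOpenTopological.Build (finspace X) opT opI op_bigU.
End Topology.

Definition chain (d : Order.disp_t) (X : finPOrderType d) (C : {set X}) : bool :=
  [forall x in C, forall y in C, x >=< y].

(* The empty poset has height -1. *)
Definition height (d : Order.disp_t) (X : finPOrderType d) : int :=
  ((\max_(C : {set X} | chain C) #|C|)%N%:Z - 1)%R.

Definition maximal_elt (d : Order.disp_t) (X : porderType d) (x : X) :=
  forall y : X, x <= y -> y = x.

End FiniteSpace.

Section SubgroupPosets.
Local Open Scope group_scope.
Context (gT : finGroupType).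

Let le_group : rel {group gT} := fun H K => H \subset K.

Let le_group_refl : reflexive le_group.
Proof. by move=> H; apply: subxx. Qed.

Let le_group_anti : antisymmetric le_group.
Proof.
by move=> H K /andP[HK KH]; apply/val_inj/eqP; rewrite finset.eqEsubset; apply/andP.
Qed.

Let le_group_trans : transitive le_group.
Proof. by move=> K H L; apply: fintype.subset_trans. Qed.

Fact group_display : Order.disp_t. Proof. exact: Order.Disp tt tt. Qed.

HB.instance Definition _ := Order.Le_isPOrder.Build group_display {group gT}
  le_group_refl le_group_anti le_group_trans.

Context (p : nat) (G : {group gT}).

Record Sp := MkSp {
  Sp_val :> {group gT};
  _ : [&& Sp_val \subset G, p.-group Sp_val & Sp_val :!=: 1]
}.

HB.instance Definition _ := [isSub for Sp_val].
HB.instance Definition _ := [Finite of Sp by <:].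
HB.instance Definition _ :=
  [SubChoice_isSubPOrder of Sp by <: with group_display].

Record Ap := MkAp {
  Ap_val :> {group gT};
  _ : [&& Ap_val \subset G, p.-abelem Ap_val & Ap_val :!=: 1]
}.

HB.instance Definition _ := [isSub for Ap_val].
HB.instance Definition _ := [Finite of Ap by <:].
HB.instance Definition _ :=
  [SubChoice_isSubPOrder of Ap by <: with group_display].

End SubgroupPosets.

(* Main.v *)
Require Import Defs.
From mathcomp Require Import all_boot all_order all_algebra.
From mathcomp Require Import all_fingroup all_solvable.
From mathcomp Require Import classical_sets reals topology normedtype.
From mathcomp Require Import boolp lra.

(** The proof passes through a normal p-torus of [G]: contractibility of S_p(G)
    produces one, and in each of the three cases a normal p-torus contracts
    A_p(G).

    From S_p(G) to a normal torus. Discarding all the up beat points of a poset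
    at once, or all its down beat points, is a retraction that does not depend
    on any choice, so what remains is stable under every order automorphism.
    Iterating leads to a retract [Y] without beat points ([char_core]), and on
    such a [Y] a monotone self-map comparable with the identity is the identity
    ([no_up_beat_rigid]).  Along a homotopy from a constant to the identity of
    [X], the maps at nearby times are comparable; retracted to [Y] they
    are therefore the identity near any time at which they are the identity,
    and connectedness of the segment makes them so at all times. Hence [Y]
    consists of a single point, fixed by all automorphisms
    ([contractible_fixed_point]).  Applied to the conjugations by [G] on S_p(G)
    this gives a normal nontrivial p-subgroup [H], and [Z = 'Ohm_1('Z(H))] is a
    normal p-torus.

    From a normal torus [Z] to a contraction of A_p(G). Let [f E] be [E] when
    [E] lies in [Z], and [E 'C_Z(E)] otherwise. A p-group acting on a p-group
    has nontrivial fixed points, so [f E] always meets [Z], and as soon as [f]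
    is monotone the comparisons [E <= f E >= f E :&: Z <= Z] contract the poset
    ([contractible_Ap]).  Monotonicity holds when every torus centralises [Z],
    and also when there is no chain of three tori ([rank2_cent_sub]).  If the
    maximal tori are conjugate, all of them contain [Z], so all tori centralise
    [Z]. If [#|G|`_p <= p ^ 3], either there is no chain of three tori, or the
    top of such a chain is an elementary abelian Sylow subgroup, and then each
    torus lies together with [Z] in an abelian Sylow subgroup. *)

Set Implicit Arguments.
Unset Strict Implicit.
Unset Printing Implicit Defensive.

Import Order.TTheory GRing.Theory Num.Theory.
Import numFieldNormedType.Exports.

(** * Beat points and the characteristic core of a finite poset *)

Section BeatPoints.
Local Open Scope order_scope.
Context (d : Order.disp_t) (X : finPOrderType d).
Implicit Types (Y : {set X}).

Definition order_auto (phi : X -> X) := {mono phi : x y / x <= y}.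

Definition up_beat Y : {set X} :=
  [set y in Y |
     [exists m in Y, (y < m) && [forall z in Y, (y < z) ==> (m <= z)]]].

(** The retraction [r] carries homotopies of [X] over to [Y]; the stability of
    [Y] under automorphisms turns a one-point [Y] into a fixed point. *)
Definition char_retract Y :=
  (forall phi, order_auto phi -> forall x, (phi x \in Y) = (x \in Y)) /\
  exists2 r : X -> X, {homo r : x y / x <= y} &
    (forall x, r x \in Y) /\ {in Y, forall y, r y = y}.

Lemma up_beatP Y y :
  reflect (y \in Y /\ exists2 m, m \in Y & y < m /\
             forall z, z \in Y -> y < z -> m <= z)
          (y \in up_beat Y).
Proof.
rewrite inE; apply: (iffP andP) => [[Yy /exists_inP[m Ym /andP[ym mP]]]|].
  split=> //; exists m => //; split=> // z Yz yz.
  by move/forall_inP/(_ _ Yz)/implyP: mP; apply.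
case=> Yy [m Ym [ym mP]]; split=> //; apply/exists_inP; exists m => //.
by rewrite ym; apply/forall_inP=> z Yz; apply/implyP; apply: mP.
Qed.

Lemma order_auto_onto phi : order_auto phi -> forall x, exists y, x = phi y.
Proof.
move=> phi_auto x; have phi_inj := inc_inj phi_auto.
by exists (invF phi_inj x); rewrite f_invF.
Qed.

Lemma poset_down_ind (P : X -> Prop) :
  (forall x, (forall y, x < y -> P y) -> P x) -> forall x, P x.
Proof.
move=> IH x; have [n] := ubnP #|[set y | x < y]|.
elim: n x => // n IHn x; rewrite ltnS => le_n; apply: IH => y xy.
apply: IHn; apply: leq_trans le_n; apply: proper_card; apply/properP; split.
  by apply/fintype.subsetP=> z; rewrite !inE; apply: lt_trans.
by exists y; rewrite !inE ?ltxx.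
Qed.

(** The subposet [Y :\: up_beat Y] is reflective in [Y]: above a beat point
    [y] the elements that are kept are also above the unique cover of [y], so by
    induction there is a least one among them. Sending [y] to it is a monotone
    retraction, and no choice of an order of removal is involved. *)
Lemma char_retract_up_beat Y :
  char_retract Y -> char_retract (Y :\: up_beat Y).
Proof.
case=> invY [r r_homo [rY r_id]]; split.
  move=> phi phi_auto x; have inv := invY phi phi_auto.
  rewrite finset.in_setD [RHS]finset.in_setD inv; congr (~~ _ && _).
  have lt_phi := leW_mono phi_auto.
  apply/up_beatP/up_beatP; rewrite inv => -[Yx [m]].
    have [m' ->] := order_auto_onto phi_auto m; rewrite inv => Ym'.
    rewrite lt_phi => -[xm' m'P]; split=> //; exists m' => //.
    split=> // z Yz xz.
    by rewrite -phi_auto m'P ?inv ?lt_phi.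
  move=> Ym [xm mP]; split=> //; exists (phi m); rewrite ?inv ?lt_phi //.
  split=> // z; have [z' ->] := order_auto_onto phi_auto z.
  by rewrite inv lt_phi phi_auto; apply: mP.
have refl y : exists m, y \in Y -> [/\ m \in Y :\: up_beat Y, y <= m &
    forall z, z \in Y :\: up_beat Y -> y <= z -> m <= z].
  elim/poset_down_ind: y => y IH.
  have [By | nBy] := boolP (y \in up_beat Y); last first.
    by exists y => Yy; split=> //; rewrite inE nBy.
  have /up_beatP[Yy [u Yu [yu uP]]] := By.
  have [m /(_ Yu) [mY um mP]] := IH u yu; exists m => _; split=> //.
    exact: le_trans (ltW yu) um.
  move=> z zY yz; apply: mP => //; apply: uP; first by case/setDP: zY.
  rewrite lt_neqAle yz andbT; apply: contraTneq zY => <-.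
  by rewrite inE By.
have /boolp.choice[c cP] := refl.
exists (c \o r) => [x y xy /=|].
  have [_ _ xP] := cP _ (rY x); have [cy ry _] := cP _ (rY y).
  by apply: xP => //; apply: le_trans (r_homo _ _ xy) ry.
split=> [x /= | y Yy /=]; first by have [] := cP _ (rY x).
have Yy' : y \in Y by case/setDP: Yy.
rewrite r_id //; have [_ yc cl] := cP _ Yy'.
by apply/le_anti; rewrite yc cl.
Qed.

(** At a maximal [y] moved by [f], the value [f y] is the least element of
    [Y] strictly above [y], because [f] fixes all the elements above [y]; so
    [y] is an up beat point. *)
Lemma no_up_beat_rigid Y (f : X -> X) :
  up_beat Y = finset.set0 -> {homo f : x y / x <= y} ->
  (forall y, y \in Y -> f y \in Y) ->
  (forall y, y \in Y -> y <= f y) -> forall y, y \in Y -> f y = y.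
Proof.
move=> noB f_homo fY f_ge; elim/poset_down_ind=> y IH Yy.
apply/eqP/negPn/negP => fy.
suff: y \in up_beat Y by rewrite noB inE.
apply/up_beatP; split=> //; exists (f y); first exact: fY.
split=> [|z Yz yz]; first by rewrite lt_neqAle eq_sym fy f_ge.
by rewrite -(IH z yz Yz) f_homo // ltW.
Qed.

End BeatPoints.

Section Core.
Local Open Scope order_scope.
Context (d : Order.disp_t) (X : finPOrderType d).

(** Down beat points are the up beat points of the dual order; this transfers
    the results on the latter to the former. *)
Lemma char_retract_dual (Y : {set X}) :
  char_retract Y <-> char_retract (X := X^d) Y.
Proof.
split=> -[invY [r r_homo rP]]; split.
- by move=> phi phi_auto; apply: invY => x y; apply: phi_auto.
- by exists r => // x y; apply: r_homo.
- by move=> phi phi_auto; apply: invY => x y; apply: phi_auto.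
- by exists r => // x y; apply: r_homo.
Qed.

Lemma char_core : exists Y : {set X},
  [/\ char_retract Y, up_beat Y = finset.set0
    & up_beat (X := X^d) Y = finset.set0].
Proof.
have: char_retract [set: X].
  by split=> [phi _ x|]; rewrite ?inE //; exists id => //; split.
have [n] := ubnP #|[set: X]|; elim: n [set: X] => // n IHn Y.
rewrite ltnS => le_n QY.
have step (B : {set X}) : B \subset Y -> B != finset.set0 ->
    (#|Y :\: B| < n)%N.
  move=> BY /finset.set0Pn[b Bb]; apply: leq_trans le_n; apply: proper_card.
  apply/properP; split; first exact: subsetDl.
  by exists b; [apply: (fintype.subsetP BY) | rewrite inE Bb].
have [B0 | Bn0] := eqVneq (up_beat Y) finset.set0; last first.
  apply: IHn (char_retract_up_beat QY); apply: step => //.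
  by apply/fintype.subsetP=> y /up_beatP[].
have [D0 | Dn0] := eqVneq (up_beat (X := X^d) Y) finset.set0; last first.
  apply: (IHn (Y :\: up_beat (X := X^d) Y)).
    apply: step => //; by apply/fintype.subsetP=> y /(@up_beatP _ X^d)[].
  by apply/char_retract_dual/char_retract_up_beat/char_retract_dual.
by exists Y.
Qed.

End Core.

(** * Homotopies of finite spaces *)

Section FiniteSpaceTopology.
Local Open Scope order_scope.
Local Open Scope classical_set_scope.

(** The set of times at which [P] holds is open and closed in the segment. *)
Lemma segment_locally_constant (R : realType) (P : R -> Prop) :
  (forall t : R, (t \in `[0, 1])%R ->
     \forall s \near t, (s \in `[0, 1])%R -> (P s <-> P t)) ->
  forall a b : R, (a \in `[0, 1])%R -> (b \in `[0, 1])%R -> P a -> P b.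
Proof.
move=> locP a b a01 b01 Pa.
pose B : set R := (`[0%R, 1%R] `&` [set t | P t])%classic.
have in01 (t : R) : `[0%R, 1%R]%classic t = (t \in `[0, 1]%R) by [].
suff BE : B = `[0%R, 1%R]%classic.
  by have [] : B b by rewrite BE in01.
apply: segment_connected; first by exists a; split.
  exists (interior [set s | (s \in `[0, 1])%R -> P s]).
    exact: open_interior.
  rewrite classical_sets.eqEsubset; split=> t -[t01 Pt]; split=> //.
    by move: (locP t t01); apply: filterS => s + s01 => /(_ s01) ->.
  exact: (interior_subset Pt t01).
exists (~` interior [set s | (s \in `[0, 1])%R -> ~ P s]).
  by apply: open_closedC; apply: open_interior.
rewrite classical_sets.eqEsubset; split=> t -[t01 Pt]; split=> //.
  by move=> /interior_subset /(_ t01).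
apply: contrapT => nPt; apply: Pt.
by move: (locP t t01); apply: filterS => s + s01 => /(_ s01) ->.
Qed.

Section Finspace.
Context (d : Order.disp_t) (X : finPOrderType d).

Lemma finspace_nbhs (x : finspace X) (A : set (finspace X)) :
  nbhs x A <-> forall y, y <= x -> A y.
Proof.
split=> [|Ax].
  by rewrite nbhsE => -[U [oU Ux] UA] y yx; apply: UA; apply: oU yx.
rewrite nbhsE; exists [set y | y <= x] => //; split; last exact: lexx.
by move=> y z yx zy; apply: le_trans yx.
Qed.

End Finspace.

Section Fences.
Context (d : Order.disp_t) (X : finPOrderType d).

Lemma homo_continuous d' (Z : finPOrderType d') (f : X -> Z) :
  {homo f : x y / x <= y} -> continuous (f : finspace X -> finspace Z).
Proof.
move=> f_homo x A /finspace_nbhs fA; apply/finspace_nbhs => y yx.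
by apply: fA; apply: f_homo.
Qed.

(** The down-set of [H (x, t)] is open and [H] is continuous at [(x, t)], so
    each [x] has a neighbourhood of [t] of the required kind; as [X] is finite,
    one neighbourhood serves all [x]. *)
Lemma homotopy_local (R : realType) d' (Z : finPOrderType d')
    (H : finspace X * R -> finspace Z) (t : R) :
  {within setT `*` `[0%R, 1%R], continuous H} -> (t \in `[0, 1])%R ->
  \forall s \near t, (s \in `[0, 1])%R ->
    forall x y : X, y <= x -> H (y, s) <= H (x, t).
Proof.
move=> /subspace_continuousP cH t01.
suff: \forall s \near t, forall x : X, (s \in `[0, 1])%R ->
    forall y : X, y <= x -> H (y, s) <= H (x, t).
  by apply: filterS => s Hs s01 x; apply: Hs.
apply: (filter_forall (nbhs_filter t)) => x.
have xt01 : (setT `*` `[0%R, 1%R]) (x, t) by [].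
have /= [|[U V] /= [/finspace_nbhs Ux Vt] UV] :=
  cH _ xt01 [set z | z <= H (x, t)].
  exact/finspace_nbhs.
apply: filterS Vt => s Vs s01 y yx.
by apply: (UV (y, s)) => //; split=> //; apply: Ux.
Qed.

(** Open sets being down-sets, a homotopy between comparable maps takes the
    smaller one on an open set of times and the larger one on a closed set. The
    fence [c >= h <= f >= id] is thus run through with [c] at time 0, [h] on
    ]0, 1/2[, [f] at 1/2 and the identity afterwards. *)
Lemma contractible_fence (R : realType) (f h : X -> X) (c : X) :
  {homo f : x y / x <= y} -> {homo h : x y / x <= y} ->
  (forall x, x <= f x) -> (forall x, h x <= f x) -> (forall x, h x <= c) ->
  contractible R (finspace X).
Proof.
move=> f_homo h_homo le_f le_hf le_hc.
exists (fun=> tt), (fun=> c); split.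
- by move=> x; apply: cst_continuous.
- by move=> x; apply: cst_continuous.
- pose F (x : X) (t : R) : X :=
    if (t <= 0)%R then c else if (t < 2^-1)%R then h x
    else if (t <= 2^-1)%R then f x else x.
  exists (fun u : finspace X * R => F u.1 u.2); split=> [|x|x]; last first.
  + by rewrite /= /F !ifF //; apply/negbTE; rewrite -?ltNge -?leNgt; lra.
  + by rewrite /= /F lexx.
  apply: continuous_subspaceT => -[x t] A /finspace_nbhs /= At.
  (* near [t], the values of [F] on the down-set of [x] all lie below [F x t] *)
  suff [V Vt FV] : exists2 V : set R, nbhs t V &
      forall s, V s -> forall y : X, y <= x -> F y s <= F x t.
    exists ([set y | y <= x], V) => /=.
      by split=> //; apply/finspace_nbhs.
    by move=> [y s] [/= yx Vs]; apply: At; apply: FV.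
  have [t0 | t0] := lerP t 0%R.
    exists [set s | (s < 2^-1)%R]; first by apply: lt_nbhsl; lra.
    by move=> s /= sh y yx; rewrite /F t0 sh; case: ifP.
  have [th | th | th] := ltrgtP t (2^-1)%R.
  + exists ([set s | (0 < s)%R] `&` [set s | (s < 2^-1)%R]).
      by apply: filterI; [apply: lt_nbhsr | apply: lt_nbhsl].
    by move=> s [/= s0 sh] y yx; rewrite /F !leNgt s0 t0 sh th /= h_homo.
  + exists [set s | (2^-1 < s)%R]; first exact: lt_nbhsr.
    move=> s /= sh y yx; rewrite /F !ifF //; apply/negbTE;
      rewrite -?ltNge -?leNgt //; lra.
  exists [set s | (0 < s)%R]; first exact: lt_nbhsr.
  move=> s /= s0 y yx; rewrite /F !(leNgt _ 0%R) s0 t0 /= th ltxx lexx.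
  have le_yf := le_trans (le_f y) (f_homo _ _ yx).
  case: ifP => _; first by apply: le_trans (le_hf y) _; apply: f_homo.
  by case: ifP => _ //; apply: f_homo.
- exists (fun=> tt); split=> //; first exact: cst_continuous.
  by move=> [].
Qed.

End Fences.
End FiniteSpaceTopology.

(** * Fixed points of contractible finite spaces *)

Section FixedPoint.
Local Open Scope order_scope.
Local Open Scope classical_set_scope.
Context (R : realType) (d : Order.disp_t) (X : finPOrderType d).

(** A retract [Y] as in [char_core] is reduced to one point: composed with the
    retraction [r], the homotopy from a constant to the identity can never leave
    the identity of [Y]. *)
Theorem contractible_fixed_point :
  contractible R (finspace X) ->
  exists x : X, forall phi : X -> X, order_auto phi -> phi x = x.
Proof.
case=> f [g [_ _ [H [H_cont H0 H1]] _]].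
have H0c x : H (x, 0%R) = g tt by rewrite H0 /=; case: (f x).
have m0 : ((0 : R) \in `[0, 1])%R by rewrite in_itv /= lexx ler01.
have m1 : ((1 : R) \in `[0, 1])%R by rewrite in_itv /= lexx ler01.
have [Y [[invY [r r_homo [rY r_id]]] noU noD]] := char_core X.
(* the time [t] itself lies in the neighbourhood given by [homotopy_local] *)
have H_homo (t : R) : (t \in `[0, 1])%R ->
    forall x y : X, x <= y -> H (x, t) <= H (y, t).
  move=> t01 x y xy.
  exact: (nbhs_singleton (homotopy_local H_cont t01)).
pose P (t : R) := forall y : X, y \in Y -> r (H (y, t)) = y.
have P0 : P 0%R.
  apply: (@segment_locally_constant R P _ 1%R) => // [t t01 | y Yy]; last first.
    by rewrite H1 r_id.
  move: (homotopy_local H_cont t01); apply: filterS => s near_s s01.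
  (* [H (_, s) <= H (_, t)]: an identity at time [s] gives a map above the
     identity at time [t], and an identity at time [t] a map below it at [s] *)
  split=> Pst.
    apply: no_up_beat_rigid noU _ _ _ => // [x y xy | y Yy].
      by apply: r_homo; apply: H_homo.
    by rewrite -{1}(Pst y Yy); apply: r_homo; apply: near_s.
  apply: (no_up_beat_rigid (X := X^d) noD) => // [x y xy | y Yy].
    by apply: r_homo; apply: H_homo.
  have : r (H (y, s)) <= r (H (y, t)) by apply: r_homo; apply: near_s.
  by rewrite Pst.
exists (r (g tt)) => phi phi_auto.
have Yphi : phi (r (g tt)) \in Y by rewrite invY.
by rewrite -[LHS]P0 // H0c.
Qed.

End FixedPoint.

(** * Normal p-tori and the contraction of A_p(G) *)

Section Groups.
Local Open Scope group_scope.
Context (gT : finGroupType) (p : nat) (G : {group gT}).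

(** Conjugations by elements of [G] are automorphisms of S_p(G), and a common
    fixed point of them is a normal subgroup. *)
Lemma contractible_Sp_normal_Ap (R : realType) :
  contractible R (finspace (Sp p G)) -> exists Z : Ap p G, G \subset 'N(Z).
Proof.
case/contractible_fixed_point=> H H_fix.
have := valP H => /and3P[HG pH ntH].
have nHG : G \subset 'N(H).
  apply/fintype.subsetP=> g Gg.
  pose phi (K : Sp p G) : Sp p G := insubd K (K :^ g)%G.
  have phiE K : val (phi K) = (K :^ g)%G.
    rewrite val_insubd ifT //=; have /and3P[KG pK ntK] := valP K.
    by rewrite pgroupJ pK conjsg_eq1 ntK conj_subG.
  have phi_auto : order_auto phi.
    move=> K L; rewrite -[LHS]/(val (phi K) \subset val (phi L)) !phiE.
    exact: conjSg.
  rewrite inE; have /(congr1 val) := H_fix phi phi_auto.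
  by rewrite phiE => /(congr1 val) /= ->.
have abZ : p.-abelem 'Ohm_1('Z(H)).
  apply: Ohm1_abelem; last exact: center_abelian.
  by apply: pgroupS pH; apply: center_sub.
have ZG : 'Ohm_1('Z(H)) \subset G.
  exact: fintype.subset_trans (Ohm_sub _ _)
    (fintype.subset_trans (center_sub _) HG).
have ntZ : 'Ohm_1('Z(H)) != 1.
  rewrite Ohm1_eq1; apply: contra ntH => /eqP Z1.
  by rewrite (trivg_center_pgroup pH).
have ZP : [&& 'Ohm_1('Z(H)) \subset G, p.-abelem 'Ohm_1('Z(H))
    & 'Ohm_1('Z(H)) != 1].
  by rewrite ZG abZ ntZ.
exists (MkAp ZP) => /=.
apply: char_norm_trans nHG.
by apply: char_trans (Ohm_char _ _) (center_char _).
Qed.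

(** In the p-group [Z E], the normal subgroup [Z] meets the centre. *)
Lemma cent_pgroup_ntriv (E Z : {group gT}) :
  p.-group E -> p.-group Z -> E \subset 'N(Z) -> Z :!=: 1 -> 'C_Z(E) != 1.
Proof.
move=> pE pZ nZE ntZ.
have pZE : p.-group (Z <*> E) by rewrite norm_joinEr // pgroupM pZ.
have nZ : Z <| Z <*> E by rewrite normalYl.
have := meet_center_nil (pgroup_nil pZE) nZ ntZ.
apply: subG1_contra; apply: finset.setIS.
by apply: fintype.subset_trans (finset.subsetIr _ _) (centS (joing_subr _ _)).
Qed.

Section CentralExtension.
Context (Z : Ap p G).

Lemma join_cent_Ap (E : Ap p G) :
  [&& E <*> 'C_Z(E) \subset G, p.-abelem (E <*> 'C_Z(E)) & E <*> 'C_Z(E) != 1].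
Proof.
have /and3P[EG abE ntE] := valP E; have /and3P[ZG abZ ntZ] := valP Z.
have cEC : 'C_Z(E) \subset 'C(E) by apply: finset.subsetIr.
apply/and3P; split.
- by rewrite join_subG EG (fintype.subset_trans (finset.subsetIl _ _)).
- rewrite (cprod_abelem p (cprodEY cEC)) abE /=.
  by apply: abelemS abZ; apply: finset.subsetIl.
- by apply: subG1_contra ntE; apply: joing_subl.
Qed.

(** The map [f] of the introduction. Tori inside [Z] are kept as they are since
    [E 'C_Z(E)] would be [Z] for each of them, which need not lie below the
    images of the larger tori. *)
Definition join_cent (E : Ap p G) : Ap p G :=
  if E \subset Z then E else MkAp (join_cent_Ap E).

(** The fence [E <= f E >= f E :&: Z <= Z]; the hypothesis on [E] and [F] is
    what makes [f] monotone. *)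
Theorem contractible_Ap (R : realType) :
  G \subset 'N(Z) ->
  (forall E F : Ap p G, E \subset F -> ~~ (E \subset Z) ->
     'C_Z(E) \subset F <*> 'C_Z(F)) ->
  contractible R (finspace (Ap p G)).
Proof.
move=> nZG C_le.
have /and3P[ZG abZ ntZ] := valP Z.
have leE (E F : Ap p G) : (E <= F)%O = (E \subset F) by [].
have ntI (E : Ap p G) : join_cent E :&: Z != 1.
  have /and3P[EG abE ntE] := valP E.
  rewrite /join_cent; case: ifP => [EZ | _ /=].
    by rewrite (finset.setIidPl EZ).
  have nZE := fintype.subset_trans EG nZG.
  apply: subG1_contra
    (cent_pgroup_ntriv (abelem_pgroup abE) (abelem_pgroup abZ) nZE ntZ).
  by rewrite finset.subsetI joing_subr finset.subsetIl.
have PI (E : Ap p G) : [&& join_cent E :&: Z \subset G,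
    p.-abelem (join_cent E :&: Z) & join_cent E :&: Z != 1].
  have IZ : join_cent E :&: Z \subset Z by apply: finset.subsetIr.
  by rewrite ntI (abelemS IZ abZ) (fintype.subset_trans IZ ZG).
have f_homo : {homo join_cent : E F / (E <= F)%O}.
  move=> E F; rewrite !leE /join_cent => EF.
  case: ifPn => EZ; case: ifPn => FZ //=.
  - exact: fintype.subset_trans EF (joing_subl _ _).
  - by rewrite (fintype.subset_trans EF FZ) in EZ.
  by rewrite join_subG (fintype.subset_trans EF (joing_subl _ _)) C_le.
apply: (@contractible_fence _ _ R join_cent (fun E => MkAp (PI E)) Z) => //.
- by move=> E F EF; rewrite leE /=; apply: finset.setSI; apply: f_homo.
- by move=> E; rewrite leE /join_cent; case: ifP => //= _; apply: joing_subl.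
- by move=> E; rewrite leE /= finset.subsetIl.
- by move=> E; rewrite leE /= finset.subsetIr.
Qed.

End CentralExtension.

Definition no_three_chain :=
  forall A B C : Ap p G, A \proper B -> B \proper C -> False.

Lemma height_no_three_chain : (height (Ap p G) <= 1)%R -> no_three_chain.
Proof.
rewrite /height lerBlDr => h2 A B C AB BC.
have AC := proper_trans AB BC.
have neq (K L : Ap p G) : K \proper L -> K != L.
  by move=> KL; apply: contraTneq KL => ->; rewrite fintype.properxx.
have leE (K L : Ap p G) : (K <= L)%O = (K \subset L) by [].
have chainABC : chain [set A; B; C].
  apply/forall_inP=> x; rewrite !inE -orbA => /or3P xP.
  apply/forall_inP=> y; rewrite !inE -orbA => /or3P yP.
  rewrite /Order.comparable !leE.
  by case: xP => /eqP->; case: yP => /eqP->;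
    rewrite ?fintype.subxx ?(proper_sub AB) ?(proper_sub BC) ?(proper_sub AC)
      ?orbT.
have := leq_trans (leq_bigmax_cond _ chainABC) h2.
by rewrite -finset.setUA cardsU1 cards2 !inE negb_or !neq.
Qed.

(** Take [E] properly contained in [F]. Since no torus lies properly above [F],
    it contains ['C_Z(F)], which is not inside [E], as otherwise it would be a
    proper subgroup of [E] and start a chain of three. Thus [E 'C_Z(F)] is a
    torus properly above [E] contained in [E 'C_Z(E)], so both are equal, and
    [E 'C_Z(F)] lies in [F]. *)
Lemma rank2_cent_sub (Z E F : Ap p G) :
  no_three_chain -> G \subset 'N(Z) -> E \subset F -> ~~ (E \subset Z) ->
  'C_Z(E) \subset F <*> 'C_Z(F).
Proof.
move=> no3 nZG EF nEZ.
have [<- | neqEF] := eqVneq E F; first exact: joing_subr.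
have prEF : E \proper F.
  rewrite finset.properEneq EF andbT; apply: contra neqEF => /eqP EF'.
  by apply/eqP/val_inj/val_inj.
have /and3P[FG abF ntF] := valP F; have /and3P[ZG abZ ntZ] := valP Z.
have ntC := cent_pgroup_ntriv (abelem_pgroup abF) (abelem_pgroup abZ)
  (fintype.subset_trans FG nZG) ntZ.
have CF : 'C_Z(F) \subset F.
  apply/negPn/negP => nCF.
  apply: (no3 E F (MkAp (join_cent_Ap Z F)) prEF) => /=.
  rewrite fintype.properE joing_subl; apply: contra nCF.
  by apply: fintype.subset_trans; apply: joing_subr.
have PC : [&& 'C_Z(F) \subset G, p.-abelem 'C_Z(F) & 'C_Z(F) != 1].
  have CZ : 'C_Z(F) \subset Z by apply: finset.subsetIl.
  by rewrite ntC (abelemS CZ abZ) (fintype.subset_trans CF FG).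
have nCE : ~~ ('C_Z(F) \subset E).
  apply/negP=> CE; apply: (no3 (MkAp PC) E F _ prEF) => /=.
  rewrite fintype.properE CE; apply: contra nEZ => /fintype.subset_trans; apply.
  exact: finset.subsetIl.
have CFE : 'C_Z(F) \subset 'C_Z(E) by apply: finset.setIS; apply: centS.
have cFF : abelian F by apply: abelem_abelian abF.
have PEC : [&& E <*> 'C_Z(F) \subset G, p.-abelem (E <*> 'C_Z(F))
    & E <*> 'C_Z(F) != 1].
  have EC_F : E <*> 'C_Z(F) \subset F by rewrite join_subG EF.
  have /and3P[_ _ ntE] := valP E.
  rewrite (fintype.subset_trans EC_F FG) (abelemS EC_F abF) /=.
  by apply: subG1_contra ntE; apply: joing_subl.
have prE : E \proper MkAp PEC.
  rewrite fintype.properE joing_subl; apply: contra nCE.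
  by apply: fintype.subset_trans; apply: joing_subr.
have sub : MkAp PEC \subset MkAp (join_cent_Ap Z E).
  by rewrite /= join_subG joing_subl (fintype.subset_trans CFE) ?joing_subr.
have sup : MkAp (join_cent_Ap Z E) \subset MkAp PEC.
  apply/negPn/negP=> nsub; apply: (no3 _ _ _ prE) => //.
  by rewrite fintype.properE; apply/andP; split; [apply: sub | apply: nsub].
apply: fintype.subset_trans (joing_subl F _).
apply: fintype.subset_trans (joing_subr E _) _.
apply: fintype.subset_trans sup _.
by rewrite /= join_subG EF.
Qed.

Lemma Ap_sub_maximal (E : Ap p G) :
  exists2 M : Ap p G, maximal_elt M & E \subset M.
Proof.
elim/poset_down_ind: E => E IH.
have [/existsP[F EF] | maxE] := boolP [exists F : Ap p G, (E < F)%O].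
  have [M maxM FM] := IH F EF; exists M => //.
  exact: fintype.subset_trans (ltW EF) FM.
exists E => // F EF; apply/eqP/negPn/negP=> neq; case/existsP: maxE.
by exists F; rewrite lt_neqAle eq_sym neq.
Qed.

(** Some maximal torus contains [Z], hence so do all its conjugates, as [Z] is
    normal; every torus lies in one of these abelian groups. *)
Lemma conj_maximal_cent (Z : Ap p G) :
  (forall A B : Ap p G, maximal_elt A -> maximal_elt B ->
     exists2 x : gT, x \in G & B :=: A :^ x) ->
  G \subset 'N(Z) -> forall E : Ap p G, E \subset 'C(Z).
Proof.
move=> conjM nZG E.
have [M maxM ZM] := Ap_sub_maximal Z; have [N maxN EN] := Ap_sub_maximal E.
have [x Gx NE] := conjM M N maxM maxN.
have /and3P[_ abN _] := valP N.
have ZN : Z \subset N.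
  by rewrite NE -(normsP nZG x Gx) conjSg.
apply: fintype.subset_trans EN _.
exact: fintype.subset_trans (abelem_abelian abN) (centS ZN).
Qed.

(** The torus [C] has order at least [p ^ 3], so it is a Sylow subgroup. Every
    torus lies in a conjugate of [C], which is abelian and contains the normal
    p-subgroup [Z]. *)
Lemma order_p3_cent (Z A B C : Ap p G) : prime p -> ((#|G|)`_p <= p ^ 3)%N ->
  A \proper B -> B \proper C -> G \subset 'N(Z) ->
  forall E : Ap p G, E \subset 'C(Z).
Proof.
move=> p_pr G3 AB BC nZG E.
have /and3P[AG abA ntA] := valP A; have /and3P[BG abB ntB] := valP B.
have /and3P[CG abC ntC] := valP C; have /and3P[ZG abZ ntZ] := valP Z.
have /and3P[EG abE ntE] := valP E.
have p_gt1 := prime_gt1 p_pr.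
have ordA := card_pgroup (abelem_pgroup abA).
have ordB := card_pgroup (abelem_pgroup abB).
have ordC := card_pgroup (abelem_pgroup abC).
have sylC : p.-Sylow(G) C.
  rewrite pHallE CG /= eqn_leq dvdn_leq ?part_gt0 //=; last first.
    by rewrite -(part_pnat_id (abelem_pgroup abC)) partn_dvd // cardSg.
  apply: leq_trans G3 _; rewrite [leqRHS]ordC leq_exp2l //.
  have a_gt0 : (0 < logn p #|A|)%N.
    by rewrite -(ltn_exp2l 0 _ p_gt1) -ordA cardG_gt1.
  have a_b : (logn p #|A| < logn p #|B|)%N.
    by rewrite -(ltn_exp2l _ _ p_gt1) -ordA -ordB proper_card.
  have b_c : (logn p #|B| < logn p #|C|)%N.
    by rewrite -(ltn_exp2l _ _ p_gt1) -ordB -ordC proper_card.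
  exact: leq_ltn_trans (leq_ltn_trans a_gt0 a_b) b_c.
have [x Gx EC] := Sylow_subJ sylC EG (abelem_pgroup abE).
have [y Gy ZC] := Sylow_subJ sylC ZG (abelem_pgroup abZ).
have ZCx : Z \subset C :^ x.
  move: ZC; rewrite -(conjSg _ _ y^-1) conjsgK (normsP nZG) ?groupV // => ZC.
  by rewrite -(normsP nZG x Gx) conjSg.
have cCx : abelian (C :^ x) by rewrite abelianJ (abelem_abelian abC).
exact: fintype.subset_trans EC (fintype.subset_trans cCx (centS ZCx)).
Qed.

Lemma central_cent_sub (Z E F : Ap p G) :
  F \subset 'C(Z) -> 'C_Z(E) \subset F <*> 'C_Z(F).
Proof.
rewrite centsC => ZF; apply: fintype.subset_trans (joing_subr F _).
by rewrite (finset.setIidPl ZF) finset.subsetIl.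
Qed.

End Groups.

Theorem proposition3p3 (R : realType) (gT : finGroupType) (G : {group gT})
    (p : nat) (p_prime : prime p)
    (cases :
      [\/ forall A B : Ap p G, maximal_elt A -> maximal_elt B ->
            exists2 x : gT, x \in G & (B :=: A :^ x)%g,
          (height (Ap p G) <= 1)%R
        | ((#|G|)`_p <= p ^ 3)%N]) :
  contractible R (finspace (Sp p G)) -> contractible R (finspace (Ap p G)).
Proof.
case/contractible_Sp_normal_Ap => Z nZG.
apply: (contractible_Ap _ nZG) => E F EF nEZ.
case: cases => [conjM | /height_no_three_chain no3 | G3].
- exact/central_cent_sub/conj_maximal_cent.
- exact: rank2_cent_sub no3 nZG EF nEZ.
(* by contradiction, so that a chain of three tori may be assumed on demand *)
apply: contrapT => nsub; apply: (nsub); apply: rank2_cent_sub => // A B C AB BC.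
apply: nsub; apply: central_cent_sub.
exact: order_p3_cent p_prime G3 AB BC nZG F.
Qed.
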